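(* Let $G$ be a group and let $A$ be a finite nonempty subset of $G$. Define \[ C(A)=\frac{|\{(a_1,a_2)\in A\times A : a_1a_2\in A\}|}{|A|^2}. \] If $C(A)\ge 1-\delta$ for some real $\delta\le 1/60$, then there exists a subgroup $K$ of $G$ such that \[ |K|\le \tfrac{10}{9}|A| \qquad\text{and}\qquad |A\cap K|\ge (1-5\delta)|A|. \] *)

(* Defs.v *)
From HB Require Import structures.
From mathcomp Require Import all_boot all_order all_algebra.
From mathcomp Require Import finmap reals.

Set Implicit Arguments.
Unset Strict Implicit.
Unset Printing Implicit Defensive.

Local Open Scope fset_scope.
Local Open Scope ring_scope.

Definition mul_pairs (G : groupType) (A : {fset G}) : {fset G * G} :=
  [fset p in A `*` A | (p.1 * p.2)%g \in A].

Definition mul_density (R : realType) (G : groupType) (A : {fset G}) : R :=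
  #|` mul_pairs A|%:R / #|` A|%:R ^+ 2.

(* Main.v *)
(** For [g] in [G] let [d g] be the number of [a] in [A] with [a * g] outside
    [A]. The function [d] is a length function: [d (g * h) <= d g + d h] and
    [d g^-1 = d g]. The hypothesis says that [d] has average at most
    [delta * |A|] over [A], so most of [A] lies in the ball [20 d <= |A|].
    If [5 d g <= |A|], some [a] and [a * g] are both in that part of [A], whence
    [10 d g <= |A|]: the balls of radius [|A| / 5] and [|A| / 10] coincide, and
    this common ball is the subgroup [K]. Double counting the pairs
    [(a, a * g)] bounds its size, and Markov's inequality gives the bound
    on [A `&` K]. *)
Require Import Defs.
From HB Require Import structures.
From mathcomp Require Import all_boot all_order all_algebra.
From mathcomp Require Import finmap reals.
From mathcomp Require Import zify lra.

Local Open Scope fset_scope.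
Local Open Scope ring_scope.

Import GRing.Theory Num.Theory.

Lemma count_inj_leq {T T' : eqType} {f : T -> T'} {s : seq T} (t : seq T') :
  injective f -> uniq s -> (count (fun x => f x \in t) s <= size t)%N.
Proof.
move=> f_inj s_uniq; rewrite -size_filter -(size_map f).
apply: uniq_leq_size; first by rewrite map_inj_uniq // filter_uniq.
by move=> _ /mapP[x + ->]; rewrite mem_filter => /andP[].
Qed.

Lemma count_leq_addU {T : eqType} {p q r : pred T} {s : seq T} :
  {in s, forall x, p x -> q x || r x} -> (count p s <= count q s + count r s)%N.
Proof.
move=> pqr; rewrite -count_predUI; apply: leq_trans (leq_addr _ _).
rewrite (eq_in_count (a2 := predI p (predU q r))) => [|x /pqr /=]; last first.
  by case: (p x) => // ->.
by apply: sub_count => x /andP[].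
Qed.

(** Markov's inequality, with the threshold [m / k] cleared of its denominator. *)
Lemma count_gt_leq_sum {T : eqType} (s : seq T) (f : T -> nat) (k m : nat) :
  (count (fun x => m < k * f x) s * m <= k * \sum_(x <- s) f x)%N.
Proof.
elim: s => [|x s IHs]; first by rewrite big_nil muln0.
rewrite big_cons /=; case: ltnP => /= H; nia.
Qed.

Definition defect {G : groupType} (A : {fset G}) (g : G) : nat :=
  count (fun a => (a * g)%g \notin A) A.

Lemma defectE {G : groupType} (A : {fset G}) (g : G) :
  (count (fun a => (a * g)%g \in A) A + defect A g = #|` A|)%N.
Proof. exact: count_predC. Qed.

Lemma defect1 {G : groupType} (A : {fset G}) : defect A 1%g = 0%N.
Proof.
apply/eqP; rewrite -leqn0 leqNgt -has_count; apply/hasPn => a aA.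
by rewrite mulg1 aA.
Qed.

(** If [a * g * h] leaves [A], then either [a * g] already does, or [a * g] is an element of [A]
    that [h] moves out; [a] determines [a * g], so the second case occurs at most [defect A h]
    times. *)
Lemma defectM {G : groupType} (A : {fset G}) (g h : G) :
  (defect A (g * h) <= defect A g + defect A h)%N.
Proof.
pose t := [seq b <- enum_fset A | (b * h)%g \notin A].
have le_h : (count (fun a => (a * g)%g \in t) A <= defect A h)%N.
  by rewrite /defect -[leqRHS]size_filter; exact: count_inj_leq _ (mulIg g) (fset_uniq A).
apply: leq_trans (leq_add (leqnn _) le_h).
apply: count_leq_addU => a aA; rewrite mem_filter mulgA => ->.
by case: (_ \in _).
Qed.

(** Translation by [g] injects the [a] in [A] with [a * g] in [A] into the [b] in [A] with
    [b * g^-1] in [A]. *)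
Lemma defectV_leq {G : groupType} (A : {fset G}) (g : G) :
  (defect A g^-1 <= defect A g)%N.
Proof.
rewrite -(leq_add2l (count (fun a => (a * g^-1)%g \in A) A)) defectE.
rewrite -(defectE A g) leq_add2r -[leqRHS]size_filter; set t := filter _ _.
rewrite (eq_in_count (a2 := fun a => (a * g)%g \in t)) => [|a aA]; last first.
  by rewrite mem_filter mulgK aA.
exact: count_inj_leq _ (mulIg g) (fset_uniq A).
Qed.

Lemma sum_defect {G : groupType} (A : {fset G}) :
  (#|` mul_pairs A| + \sum_(a <- A) defect A a = #|` A| * #|` A|)%N.
Proof.
have -> : #|` mul_pairs A| = (\sum_(a <- A) count (fun b => (b * a)%g \in A) A)%N.
  rewrite card_fset_sum1 big_fset big_mkcond /= big_imfset2 /=; last first.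
    by move=> [? ?] [? ?] _ _ /= [-> ->].
  by rewrite exchange_big; apply: eq_bigr => a _; rewrite -big_mkcond sum1_count.
rewrite -big_split /= (eq_bigr (fun=> #|` A|)) => [|a _]; last exact: defectE.
by rewrite big_const_seq count_predT iter_addn_0 mulnC.
Qed.

(** An [a] in [A] fails if [B a] fails, if [a * g] leaves [A], or if [a * g] is in [A] but outside
    [B]; the first and third cases each cost at most [count (predC B) A]. *)
Lemma near_translate {G : groupType} (A : {fset G}) (g : G) (B : pred G) :
  (2 * count (predC B) A + defect A g < #|` A|)%N ->
  exists2 a, B a & B (a * g)%g.
Proof.
move=> lt_A; pose t := [seq b <- enum_fset A | ~~ B b].
have le_t : (count (fun a => (a * g)%g \in t) A <= count (predC B) A)%N.
  by rewrite -[leqRHS]size_filter; exact: count_inj_leq _ (mulIg g) (fset_uniq A).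
have [/hasP[a _ /andP[Ba Bag]]|/hasPn noB] :=
  boolP (has (fun a => B a && B (a * g)%g) A); first by exists a.
have le_A : (#|` A| <= count (predC B) A + count (fun a => ~~ B (a * g)%g) A)%N.
  rewrite -[#|` A|]count_predT; apply: count_leq_addU => a aA _.
  by rewrite /= -negb_and noB.
have le_g : (count (fun a => ~~ B (a * g)%g) A
    <= defect A g + count (fun a => (a * g)%g \in t) A)%N.
  apply: count_leq_addU => a aA nBag.
  by rewrite mem_filter nBag; case: (_ \in _).
lia.
Qed.

Lemma defect_translates {G : groupType} (A : {fset G}) (g : G) :
  (defect A g < #|` A|)%N ->
  exists a b, [/\ a \in A, b \in A & g = (a^-1 * b)%g].
Proof.
move=> lt_g; have: has (fun a => (a * g)%g \in A) A.
  by rewrite has_count; have := defectE A g; lia.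
by case/hasP=> a aA agA; exists a, (a * g)%g; rewrite mulKg.
Qed.

(** Count the pairs [(a, g)] with [a * g] in [A]: each [a] has at most |A| partners in [K], each [g]
    at least 9/10 |A| in [A]. *)
Lemma card_small_defect {G : groupType} (A K : {fset G}) :
  A != fset0 -> {in K, forall g, 10 * defect A g <= #|` A|}%N ->
  (9 * #|` K| <= 10 * #|` A|)%N.
Proof.
rewrite -cardfs_gt0 => A_gt0 K_small.
have le_KA : (\sum_(g <- K) count (fun a => (a * g)%g \in A) A <= #|` A| * #|` A|)%N.
  under eq_bigr do rewrite -sum1_count big_mkcond.
  rewrite exchange_big /= -[X in (_ <= X * _)%N]count_predT -sum1_count big_distrl /=.
  apply: leq_sum => a _; rewrite mul1n -big_mkcond sum1_count.
  exact: count_inj_leq _ (mulgI a) (fset_uniq K).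
have ge_KA : (9 * #|` A| * #|` K|
    <= 10 * \sum_(g <- K) count (fun a => (a * g)%g \in A) A)%N.
  rewrite (card_fset_sum1 K) !big_distrr /= [leqLHS]big_seq [leqRHS]big_seq.
  apply: leq_sum => g /K_small le_g.
  rewrite -[count _ _](addnK (defect A g)) defectE muln1.
  by move: le_g; set n := #|` A|; lia.
nia.
Qed.

Lemma exists_defect_subgroup {G : groupType} (A : {fset G}) :
  A != fset0 -> (60 * \sum_(a <- A) defect A a <= #|` A| * #|` A|)%N ->
  exists K : {fset G}, [/\ group_closed (mem K),
    (9 * #|` K| <= 10 * #|` A|)%N
    & (#|` A| * #|` A| <= #|` A `&` K| * #|` A| + 5 * \sum_(a <- A) defect A a)%N].
Proof.
move=> A_neq0 le_D; have A_gt0 : (0 < #|` A|)%N by rewrite cardfs_gt0.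
have gap g : (5 * defect A g <= #|` A|)%N -> (10 * defect A g <= #|` A|)%N.
  move=> le_g; have [|a Ba Bag] :=
    near_translate A g (fun a => 20 * defect A a <= #|` A|)%N.
    (* By Markov at most a third of [A] violates the bound, and 2/3 + 1/5 < 1. *)
    have := count_gt_leq_sum A (defect A) 20 #|` A|.
    rewrite -(eq_count (a1 := predC (fun a => 20 * defect A a <= #|` A|)%N))
      => [|a]; last by rewrite /= -ltnNge.
    move: A_gt0 le_D le_g; set n := #|` A|; set D := bigop _ _ _; set c := count _ _.
    move=> n_gt0 le_D le_g le_c; suff : (3 * c <= n)%N by lia.
    by rewrite -(leq_pmul2r n_gt0); lia.
  have := defectM A a^-1 (a * g); have := defectV_leq A a.
  by rewrite mulKg; lia.
(* Cutting the ball out of the finite set of quotients [a^-1 * b] makes it an [fset]; by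
   [defect_translates] no element is lost. *)
pose K := [fset g in [fset (a^-1 * b)%g | a in A, b in A]
            | (10 * defect A g <= #|` A|)%N].
have inK g : (g \in K) = (5 * defect A g <= #|` A|)%N.
  apply/idP/idP => [|le_g]; first by rewrite !inE /= => /andP[_]; lia.
  rewrite !inE /= gap // andbT.
  have [|a [b [aA bA ->]]] := defect_translates A g; first by lia.
  exact: in_imfset2.
exists K; split.
- split=> [|g h]; first by rewrite [_ \in _]inK defect1.
  rewrite [g \in _]inK [h \in _]inK [_ \in _]inK => /gap le_g /gap le_h.
  (* Two radii |A| / 10 add up to |A| / 5, which is again enough for membership. *)
  apply: (@leq_trans (5 * (defect A g + defect A h))); last by lia.
  rewrite leq_mul2l /=; apply: leq_trans (defectM A g h^-1) _.
  by rewrite leq_add2l defectV_leq.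
- by apply: card_small_defect => // g; rewrite inK => /gap.
(* Elements of [A] outside [K] have defect above |A| / 5; this larger radius gives the factor 5. *)
have := count_gt_leq_sum A (defect A) 5 #|` A|.
rewrite -(eq_count (a1 := predC (mem K))) => [|a]; last first.
  by rewrite /= inK -ltnNge.
have <- : count (mem K) A = #|` A `&` K|.
  rewrite -size_filter; apply/perm_size/uniq_perm; rewrite ?filter_uniq //.
  by move=> a; rewrite mem_filter in_fsetI andbC.
have := count_predC (mem K) A.
set n := #|` A|; set D := bigop _ _ _; set c := count _ _; set c' := count _ _; nia.
Qed.

Theorem theorem5p1 (R : realType) (G : groupType) (A : {fset G}) (delta : R)
    (A_neq0 : A != fset0)
    (delta_le : delta <= 1 / 60%:R)
    (CA_ge : 1 - delta <= mul_density R A) :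
  exists K : {fset G},
    [/\ group_closed (mem K),
        #|` K|%:R <= 10%:R / 9%:R * #|` A|%:R :> R
      & (1 - 5%:R * delta) * #|` A|%:R <= #|` A `&` K|%:R].
Proof.
have A_gt0 : 0 < #|` A|%:R :> R by rewrite ltr0n cardfs_gt0.
set D := (\sum_(a <- A) defect A a)%N.
have le_D : D%:R <= delta * #|` A|%:R ^+ 2.
  have /(congr1 (fun n => n%:R : R)) := sum_defect A.
  rewrite natrD natrM -/D => sumE.
  move: CA_ge; rewrite /mul_density ler_pdivlMr ?exprn_gt0 //; nra.
have [||K [K_grp K_card AK_card]] := exists_defect_subgroup A => //.
  by rewrite -(ler_nat R) !natrM -/D; nra.
exists K; split=> //.
  by move: K_card; rewrite -(ler_nat R) !natrM; lra.
move: AK_card; rewrite -(ler_nat R) natrD !natrM -/D => AK_card.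
(* The integer bound carries an extra factor |A|, restored here before comparing with [le_D]. *)
by rewrite -(ler_pM2r A_gt0); nra.
Qed.
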